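(* Let $K$ be a field and $n>2$. Then the $\mathrm{id}$-matching structures on $UT_n(K)$ are exactly the associative products on $UT_n(K)$ that are $K$-linear combinations of the following bilinear products: (1) $\mathbf{M}^{\mathrm{id},1}_{i,j}$ for $1<i\le n$, $1\le j<n$: $e_{i-1,i}*e_{jl}=e_{1l}$ for all $j<l\le n$; (2) $\mathbf{M}^{\mathrm{id},2}_{i,j}$ for $1<i\le n$, $1\le j<n$, $(i,j)\ne(2,n-1)$: $e_{ki}*e_{j,j+1}=e_{kn}$ for all $1\le k<i$; (3) $\mathbf{M}^{\mathrm{id},3}_{i,j}$ for $2<i\le j+1<n$: $e_{ki}*e_{jl}=e_{kl}$ for all $1\le k<i$ and $j<l\le n$; (4) $\mathbf{M}^{\mathrm{id},4}_{i,j}$ for $2<i\le n$, $1\le j<n-1$: $e_{i-1,i}*e_{j,j+1}=e_{1n}$. In each item, the products of pairs of basis elements that are not listed are zero.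
   Context: $K$ is an arbitrary field; all products are $K$-bilinear. $UT_n(K)$ is the associative algebra of strictly upper triangular $n\times n$ matrices over $K$ with the usual matrix product $\cdot$; it has the $K$-basis of matrix units $e_{ij}$ (also written $e_{i,j}$), $1\le i<j\le n$, with $e_{ij}\cdot e_{kl}=\delta_{jk}e_{il}$. An $\mathrm{id}$-matching structure on an associative algebra $(A,\cdot)$ is an associative bilinear product $*$ on the vector space $A$ such that $(a\cdot b)*c=a\cdot(b*c)$ and $(a*b)\cdot c=a*(b\cdot c)$ for all $a,b,c\in A$. Linear combinations of products are taken in the vector space of bilinear maps $UT_n(K)\times UT_n(K)\to UT_n(K)$. *)

(* Defs.v *)
From HB Require Import structures.
From mathcomp Require Import all_boot all_order all_algebra.

Set Implicit Arguments.
Unset Strict Implicit.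
Unset Printing Implicit Defensive.

Import GRing.Theory.
Local Open Scope ring_scope.

Definition is_bilinear (K : fieldType) (A : lmodType K) (op : A -> A -> A) :=
  (forall y, linear (op^~ y)) /\ (forall x, linear (op x)).

Record id_matching (K : fieldType) (A : lmodType K) (dot star : A -> A -> A) :
    Prop := IdMatching {
  idm_bilinear : is_bilinear star;
  idm_assoc : associative star;
  idm_dot_star : forall a b c, star (dot a b) c = dot a (star b c);
  idm_star_dot : forall a b c, dot (star a b) c = star a (dot b c)
}.

Section UT.
Variables (K : fieldType) (n : nat).

Definition strict_upper : {pred 'M[K]_n} := fun A =>
  [forall i : 'I_n, forall j : 'I_n, (j <= i)%N ==> (A i j == 0)].

Lemma strict_upperP (A : 'M[K]_n) :
  reflect (forall i j : 'I_n, (j <= i)%N -> A i j = 0) (A \in strict_upper).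
Proof.
apply: (iffP forallP) => [H i j ji | H i].
  by have /forallP/(_ j)/implyP/(_ ji)/eqP := H i.
by apply/forallP => j; apply/implyP => ji; rewrite H.
Qed.

Lemma strict_upper_submod : submod_closed strict_upper.
Proof.
split=> [|a A B /strict_upperP hA /strict_upperP hB]; apply/strict_upperP => i j ji.
  by rewrite mxE.
by rewrite !mxE hA // hB // mulr0 addr0.
Qed.

HB.instance Definition _ :=
  GRing.isSubmodClosed.Build K 'M[K]_n strict_upper strict_upper_submod.

Record ut := UT { ut_val :> 'M[K]_n; _ : ut_val \in strict_upper }.

HB.instance Definition _ := [isSub for ut_val].
HB.instance Definition _ := [Choice of ut by <:].
HB.instance Definition _ := [SubChoice_isSubZmodule of ut by <:].
HB.instance Definition _ := [SubZmodule_isSubLmodule of ut by <:].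

Lemma ut_mul_subproof (x y : ut) : x *m y \in strict_upper.
Proof.
have /strict_upperP hx := valP x; have /strict_upperP hy := valP y.
apply/strict_upperP => i j ji; rewrite mxE big1 // => k _.
have [ki|ik] := leqP k i; first by rewrite hx // mul0r.
by rewrite hy ?mulr0 // (leq_trans ji) // ltnW.
Qed.

Definition ut_mul (x y : ut) : ut := UT (ut_mul_subproof x y).

Lemma ut_mulA : associative ut_mul.
Proof. by move=> x y z; apply: val_inj; rewrite /= mulmxA. Qed.

Lemma ut_e_subproof (p q : nat) :
  (\matrix_(i < n, j < n) ([&& i < j, i.+1 == p & j.+1 == q]%N)%:R : 'M[K]_n)
    \in strict_upper.
Proof. by apply/strict_upperP => i j ji; rewrite mxE ltnNge ji. Qed.

(* [ut_e p q] is the matrix unit e_{pq} with rows and columns numbered from 1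
   (ordinals being numbered from 0, hence the successors); it is 0 unless
   1 <= p < q <= n. *)
Definition ut_e (p q : nat) : ut := UT (ut_e_subproof p q).

Lemma ut_e_mul (i j k l : nat) :
  (0 < i < j)%N -> (j <= n)%N -> (0 < k < l)%N -> (l <= n)%N ->
  ut_mul (ut_e i j) (ut_e k l) = if j == k then ut_e i l else 0.
Proof.
case: i j k l => [|i] [|j] [|k] [|l] //=; rewrite ?ltnS => ij jn kl ln.
apply: val_inj; apply/matrixP => a b; rewrite mxE /= (bigD1 (Ordinal jn)) //=.
rewrite big1 ?addr0 => [|m mj]; last first.
  by rewrite !mxE ?eqSS -val_eqE /= in mj *; rewrite (negPf mj) !andbF mul0r.
rewrite !mxE /= ?eqSS; case: (eqVneq j k) kl ij => [<-|jk] jl ij; rewrite !mxE /= ?eqSS.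
  rewrite eqxx andbT -natrM mulnb /=; congr ((nat_of_bool _)%:R).
  case: (eqVneq (a : nat) i) => [->|_]; rewrite ?andbF //=.
  case: (eqVneq (b : nat) l) => [->|_]; rewrite ?andbF //=.
  by rewrite ij jl (ltn_trans ij jl).
by rewrite ?(negPf jk) ?andbF /= ?mulr0.
Qed.

(* The bilinear product with multiplication table e_{ab} * e_{cd} = t a b c d,
   the indices of t being numbered from 1. *)
Definition ut_ext (t : nat -> nat -> nat -> nat -> ut) (x y : ut) : ut :=
  \sum_(a < n) \sum_(b < n) \sum_(c < n) \sum_(d < n)
    (x a b * y c d) *: t a.+1 b.+1 c.+1 d.+1.

Lemma ut_ext_bilinear t : is_bilinear (ut_ext t).
Proof.
split=> [y c x x'|x c y y']; rewrite /ut_ext scaler_sumr -big_split;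
  apply: eq_bigr => i _; rewrite scaler_sumr -big_split;
  apply: eq_bigr => j _; rewrite scaler_sumr -big_split;
  apply: eq_bigr => k _; rewrite scaler_sumr -big_split;
  apply: eq_bigr => l _; rewrite /= !mxE scalerA -scalerDl; congr (_ *: _).
  by rewrite mulrDl mulrA.
by rewrite mulrDr mulrCA.
Qed.

Definition M1 (i j : nat) := ut_ext (fun a b c d =>
  if [&& a == i.-1, b == i & c == j]%N then ut_e 1 d else 0).

Definition M2 (i j : nat) := ut_ext (fun a b c d =>
  if [&& b == i, c == j & d == j.+1]%N then ut_e a n else 0).

Definition M3 (i j : nat) := ut_ext (fun a b c d =>
  if (b == i) && (c == j) then ut_e a d else 0).

Definition M4 (i j : nat) := ut_ext (fun a b c d =>
  if [&& a == i.-1, b == i, c == j & d == j.+1]%N then ut_e 1 n else 0).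

Definition in_M_span (star : ut -> ut -> ut) : Prop :=
  exists c1 c2 c3 c4 : nat -> nat -> K, forall x y : ut,
    star x y =
      \sum_(1 <= i < n.+1) \sum_(1 <= j < n.+1 | (1 < i <= n)%N && (1 <= j < n)%N)
        c1 i j *: M1 i j x y
    + \sum_(1 <= i < n.+1) \sum_(1 <= j < n.+1
          | [&& (1 < i <= n)%N, (1 <= j < n)%N & (i, j) != (2, n.-1)%N])
        c2 i j *: M2 i j x y
    + \sum_(1 <= i < n.+1) \sum_(1 <= j < n.+1 | (2 < i <= j.+1)%N && (j.+1 < n)%N)
        c3 i j *: M3 i j x y
    + \sum_(1 <= i < n.+1) \sum_(1 <= j < n.+1 | (2 < i <= n)%N && (1 <= j < n.-1)%N)
        c4 i j *: M4 i j x y.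

Lemma ut_ext_e t (a b c d : nat) :
  (0 < a < b)%N -> (b <= n)%N -> (0 < c < d)%N -> (d <= n)%N ->
  ut_ext t (ut_e a b) (ut_e c d) = t a b c d.
Proof.
case: a b c d => [|a] [|b] [|c] [|d] //=; rewrite ?ltnS => ab bn cd dn.
have an := ltn_trans ab bn; have cn := ltn_trans cd dn.
rewrite /ut_ext.
rewrite (bigD1 (Ordinal an)) //= (bigD1 (Ordinal bn)) //=.
rewrite (bigD1 (Ordinal cn)) //= (bigD1 (Ordinal dn)) //=.
rewrite !mxE /= ab cd !eqxx mulr1 scale1r !big1 ?addr0 //.
- move=> i ia; rewrite big1 // => j _; rewrite big1 // => k _; rewrite big1 // => l _.
  by rewrite mxE eqSS -val_eqE /= in ia *; rewrite (negPf ia) /= andbF mul0r scale0r.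
- move=> j jb; rewrite big1 // => k _; rewrite big1 // => l _.
  by rewrite mxE !eqSS -val_eqE /= in jb *; rewrite (negPf jb) !andbF mul0r scale0r.
- move=> k kc; rewrite big1 // => l _.
  by rewrite [X in _ * X]mxE !eqSS -val_eqE /= in kc *; rewrite (negPf kc) !andbF mulr0 scale0r.
- move=> l ld.
  by rewrite [X in _ * X]mxE !eqSS -val_eqE /= in ld *; rewrite (negPf ld) !andbF mulr0 scale0r.
Qed.

End UT.

(* Main.v *)
Require Import Defs.
From mathcomp Require Import all_boot all_order all_algebra.
From mathcomp Require Import zify.

(** The two compatibility identities say that a bilinear product [star] is left
    [UT_n]-linear in its first argument and right [UT_n]-linear in its second;
    call such a product a bimodule product.  Associativity of [star] appears on
    both sides of the equivalence, so the content of the theorem is that the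
    bimodule products are exactly the linear combinations of the four families.

    Every family member is a bimodule product: this is read off its
    multiplication table, and the property is stable under linear combinations
    ([M_comb_bimodule_product]).

    Conversely, [UT_n] is generated as an algebra by the simple matrix units
    [e_{i-1,i}], so a bimodule product is determined by its values
    [F(i,j) = e_{i-1,i} * e_{j,j+1}] ([eq_bimodule_product_gen]).  For
    [1 < p] and [p <> i-1], the identity
    [e_{1p} F(i,j) = (e_{1p} e_{i-1,i}) * e_{j,j+1} = 0] kills row [p] of
    [F(i,j)] ([bimodule_product_row0]); symmetrically, only the columns [j+1]
    and [n] survive ([bimodule_product_col0]).  Hence [F(i,j)] is a combination
    of [e_{1,j+1}], [e_{i-1,n}], [e_{i-1,j+1}] and [e_{1n}], and these are the
    values at the same pair of [M1 i j], [M2 i j], [M3 i j] and [M4 i j].  The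
    index restrictions on [M2], [M3] and [M4] remove the coincidences
    between the four positions (when [i = 2] or [j = n-1]) and the positions
    on or below the diagonal (when [i > j+1] in [M3]), so the four entries of
    [F(i,j)] can be taken as the coefficients ([bimodule_product_span]). *)

Section IdMatchingProducts.
Set Implicit Arguments.
Unset Strict Implicit.
Unset Printing Implicit Defensive.
Import GRing.Theory.
Local Open Scope ring_scope.

Variables (K : fieldType) (n : nat).
Notation utn := (ut K n).
Notation e := (ut_e K n).
Implicit Types (x y z : utn) (star f g : utn -> utn -> utn).

(** * Coordinates and induction on the basis of matrix units *)

(** Entries are indexed by natural numbers starting at 1, like the matrix units
    [ut_e]; this avoids building ordinals for rows such as [i.-1]. *)
Definition coord x (p q : nat) : K :=
  \sum_(a < n | a.+1 == p) \sum_(b < n | b.+1 == q) x a b.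

Lemma coordE x (a b : 'I_n) : coord x a.+1 b.+1 = x a b.
Proof. by rewrite /coord (big_pred1 a) ?(big_pred1 b). Qed.

Lemma coordD x y p q : coord (x + y) p q = coord x p q + coord y p q.
Proof.
rewrite /coord -big_split; apply: eq_bigr => a _.
by rewrite -big_split; apply: eq_bigr => b _; rewrite mxE.
Qed.

Lemma coordZ c x p q : coord (c *: x) p q = c * coord x p q.
Proof.
rewrite /coord mulr_sumr; apply: eq_bigr => a _.
by rewrite mulr_sumr; apply: eq_bigr => b _; rewrite mxE.
Qed.

Lemma coord0 p q : coord 0 p q = 0.
Proof. by rewrite -[0 in LHS](scale0r 0) coordZ mul0r. Qed.

Lemma coord_e a b p q : (0 < a < b)%N -> (b <= n)%N ->
  coord (e a b) p q = ((p == a) && (q == b))%:R.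
Proof.
case: a b => [|a] [|b] //=; rewrite !ltnS => ab bn.
have [/andP[/eqP-> /eqP->]|pq] := boolP ((p == a.+1) && (q == b.+1)).
  by rewrite (coordE _ (Ordinal (ltn_trans ab bn)) (Ordinal bn)) mxE /= ab !eqxx.
rewrite /coord big1 // => i /eqP ip; rewrite big1 // => j /eqP jq.
by rewrite mxE ip jq (negPf pq) andbF.
Qed.

Lemma eq_coord x y :
    (forall p q, (0 < p < q)%N -> (q <= n)%N -> coord x p q = coord y p q) ->
  x = y.
Proof.
move=> xy; apply: val_inj; apply/matrixP => a b; rewrite -!coordE.
have [ba|ab] := leqP b a; last exact: xy.
by rewrite !coordE !(strict_upperP _ (valP _)).
Qed.

(** Linear and multilinear identities on [ut K n] are all proved by this
    induction, which dispenses with packing each map involved as a linear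
    structure. *)
Lemma ut_basis_ind (P : utn -> Prop) :
    P 0 -> (forall c x y, P x -> P y -> P (c *: x + y)) ->
    (forall a b, (0 < a < b)%N -> (b <= n)%N -> P (e a b)) ->
  forall x, P x.
Proof.
move=> P0 Plin Pe x.
have Psum I (r : seq I) (Q : pred I) (F : I -> utn) :
    (forall i, Q i -> P (F i)) -> P (\sum_(i <- r | Q i) F i).
  move=> PF; apply: (big_ind P) => // y z Py Pz.
  by rewrite -[y]scale1r; apply: Plin.
have -> : x = \sum_(a < n) \sum_(b < n | (a < b)%N) x a b *: e a.+1 b.+1.
  apply: val_inj; apply/matrixP => a b; rewrite -!coordE.
  have coord_sum I (r : seq I) (Q : pred I) (F : I -> utn) p q :
      coord (\sum_(i <- r | Q i) F i) p q = \sum_(i <- r | Q i) coord (F i) p q.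
    by elim/big_rec2: _ => [|i u v _ <-]; [exact: coord0 | exact: coordD].
  rewrite coord_sum (bigD1 a) //= coord_sum [X in _ + X]big1 ?addr0 => [|i ia].
    have [ba|ab] := leqP b a.
      rewrite coordE (strict_upperP _ (valP _)) // big1 // => j aj.
      rewrite coordZ coord_e // !eqSS (ltn_eqF (leq_ltn_trans ba aj)).
      by rewrite andbF mulr0.
    rewrite (bigD1 b) //= big1 ?addr0 => [|j /andP[aj jb]].
      by rewrite coordZ coord_e // !eqxx mulr1 coordE.
    rewrite coordZ coord_e // !eqSS !val_eqE [b == j]eq_sym (negPf jb).
    by rewrite andbF mulr0.
  rewrite coord_sum big1 // => j ij.
  by rewrite coordZ coord_e // !eqSS !val_eqE eq_sym (negPf ia) mulr0.
apply: (Psum) => a _; apply: (Psum) => b ab; rewrite -[_ *: _]addr0.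
by apply: Plin => //; apply: Pe.
Qed.

Lemma linear_map0 (h : utn -> utn) : linear h -> h 0 = 0.
Proof.
by move=> hl; have := hl (- 1) 0 0; rewrite scaler0 addr0 scaleN1r addNr.
Qed.

Lemma eq_linear_e (h k : utn -> utn) : linear h -> linear k ->
    (forall a b, (0 < a < b)%N -> (b <= n)%N -> h (e a b) = k (e a b)) ->
  h =1 k.
Proof.
move=> hl kl hk; apply: ut_basis_ind => // [|c x y hx hy].
  by rewrite !linear_map0.
by rewrite hl kl hx hy.
Qed.

Lemma ut_mul_bilinear : is_bilinear (@ut_mul K n).
Proof.
split=> [y c x z|x c y z]; apply: val_inj => /=.
  by rewrite mulmxDl -scalemxAl.
by rewrite mulmxDr -scalemxAr.
Qed.

Lemma ut_mul0r x : ut_mul 0 x = 0.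
Proof. by apply: val_inj; rewrite /= mul0mx. Qed.

Lemma ut_mulr0 x : ut_mul x 0 = 0.
Proof. by apply: val_inj; rewrite /= mulmx0. Qed.

Lemma coord_mul_e a b x q : (0 < a < b)%N -> (b <= n)%N ->
  coord (ut_mul (e a b) x) a q = coord x b q.
Proof.
move=> ab bn; elim/ut_basis_ind: x => [|c x y xq yq|k l kl ln].
- by rewrite ut_mulr0 !coord0.
- by rewrite ut_mul_bilinear.2 !coordD !coordZ xq yq.
- rewrite ut_e_mul // coord_e //; case: (eqVneq b k) kl => [<-|_] kl.
    by rewrite coord_e ?eqxx //; lia.
  by rewrite coord0.
Qed.

Lemma coord_e_mul a b x p : (0 < a < b)%N -> (b <= n)%N ->
  coord (ut_mul x (e a b)) p b = coord x p a.
Proof.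
move=> ab bn; elim/ut_basis_ind: x => [|c x y xp yp|k l kl ln].
- by rewrite ut_mul0r !coord0.
- by rewrite ut_mul_bilinear.1 !coordD !coordZ xp yp.
- rewrite ut_e_mul // coord_e //; case: (eqVneq l a) kl ln => [->|_] kl ln.
    by rewrite coord_e ?eqxx //; lia.
  by rewrite coord0 andbF.
Qed.

(** * Bimodule products *)

(** The notion [id_matching] with associativity removed: unlike the latter, it
    is stable under linear combinations. *)
Record bimodule_product star : Prop := BimoduleProduct {
  bimod_bilinear : is_bilinear star;
  bimod_dot_star : forall x y z, star (ut_mul x y) z = ut_mul x (star y z);
  bimod_star_dot : forall x y z, ut_mul (star x y) z = star x (ut_mul y z)
}.

Lemma eq_bimodule_product f g : f =2 g -> bimodule_product f -> bimodule_product g.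
Proof.
move=> fg [[f1 f2] fl fr]; split; first split.
- by move=> y c x z; rewrite /= -!fg f1.
- by move=> x c y z; rewrite -!fg f2.
- by move=> x y z; rewrite -!fg fl.
- by move=> x y z; rewrite -!fg fr.
Qed.

Lemma bimodule_product0 : bimodule_product (fun _ _ => 0).
Proof.
split; first split.
- by move=> y c x z; rewrite scaler0 addr0.
- by move=> x c y z; rewrite scaler0 addr0.
- by move=> x y z; rewrite ut_mulr0.
- by move=> x y z; rewrite ut_mul0r.
Qed.

Lemma bimodule_productDZ c f g : bimodule_product f -> bimodule_product g ->
  bimodule_product (fun x y => c *: f x y + g x y).
Proof.
move=> [[f1 f2] fl fr] [[g1 g2] gl gr]; split; first split.
- move=> y d x z /=; rewrite f1 g1 !scalerDr !scalerA (mulrC d) -!addrA.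
  by congr (_ + _); rewrite addrCA.
- move=> x d y z /=; rewrite f2 g2 !scalerDr !scalerA (mulrC d) -!addrA.
  by congr (_ + _); rewrite addrCA.
- by move=> x y z; rewrite ut_mul_bilinear.2 fl gl.
- by move=> x y z; rewrite ut_mul_bilinear.1 fr gr.
Qed.

Lemma bimodule_productD f g : bimodule_product f -> bimodule_product g ->
  bimodule_product (fun x y => f x y + g x y).
Proof.
move=> fP gP; apply: eq_bimodule_product (bimodule_productDZ 1 fP gP) => x y.
by rewrite scale1r.
Qed.

Lemma bimodule_product_sum I (r : seq I) (Q : pred I) (F : I -> utn -> utn -> utn) :
    (forall i, Q i -> bimodule_product (F i)) ->
  bimodule_product (fun x y => \sum_(i <- r | Q i) F i x y).
Proof.
move=> FP; elim: r => [|i r IHr].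
  by apply: eq_bimodule_product bimodule_product0 => x y; rewrite big_nil.
have [Qi|nQi] := boolP (Q i).
  apply: eq_bimodule_product (bimodule_productD (FP i Qi) IHr) => x y.
  by rewrite big_cons Qi.
by apply: eq_bimodule_product IHr => x y; rewrite big_cons (negPf nQi).
Qed.

Lemma bimodule_productZ c f : bimodule_product f ->
  bimodule_product (fun x y => c *: f x y).
Proof.
move=> fP; apply: eq_bimodule_product (bimodule_productDZ c fP bimodule_product0).
by move=> x y; rewrite addr0.
Qed.

(** Both compatibility identities are trilinear. *)
Lemma bimodule_product_on_basis star : is_bilinear star ->
    (forall a b c d p q, (0 < a < b)%N -> (b <= n)%N -> (0 < c < d)%N ->
       (d <= n)%N -> (0 < p < q)%N -> (q <= n)%N ->
       star (ut_mul (e a b) (e c d)) (e p q)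
         = ut_mul (e a b) (star (e c d) (e p q))
       /\ ut_mul (star (e a b) (e c d)) (e p q)
         = star (e a b) (ut_mul (e c d) (e p q))) ->
  bimodule_product star.
Proof.
have [d1 d2] := ut_mul_bilinear.
move=> [s1 s2] H; split=> // x y z.
- apply: (@eq_linear_e (fun x => star (ut_mul x y) z)
                       (fun x => ut_mul x (star y z))) => [k u v|k u v|a b ab bn].
  + by rewrite d1 s1.
  + by rewrite d1.
  apply: (@eq_linear_e (fun y => star (ut_mul (e a b) y) z)
            (fun y => ut_mul (e a b) (star y z))) => [k u v|k u v|c d cd dn].
  + by rewrite d2 s1.
  + by rewrite s1 d2.
  apply: (@eq_linear_e (fun z => star (ut_mul (e a b) (e c d)) z)
            (fun z => ut_mul (e a b) (star (e c d) z))) => [k u v|k u v|p q pq qn].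
  + by rewrite s2.
  + by rewrite s2 d2.
  by case: (H a b c d p q).
- apply: (@eq_linear_e (fun x => ut_mul (star x y) z)
                       (fun x => star x (ut_mul y z))) => [k u v|k u v|a b ab bn].
  + by rewrite s1 d1.
  + by rewrite s1.
  apply: (@eq_linear_e (fun y => ut_mul (star (e a b) y) z)
            (fun y => star (e a b) (ut_mul y z))) => [k u v|k u v|c d cd dn].
  + by rewrite s2 d1.
  + by rewrite d1 s2.
  apply: (@eq_linear_e (fun z => ut_mul (star (e a b) (e c d)) z)
            (fun z => star (e a b) (ut_mul (e c d) z))) => [k u v|k u v|p q pq qn].
  + by rewrite d2.
  + by rewrite d2 s2.
  by case: (H a b c d p q).
Qed.

(** The previous criterion with both products replaced by their multiplication
    tables, so that checking it for a given table is only a case analysis on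
    indices. *)
Lemma bimodule_product_ext (t : nat -> nat -> nat -> nat -> utn) :
    (forall a b c d p q, (0 < a < b)%N -> (b <= n)%N -> (0 < c < d)%N ->
       (d <= n)%N -> (0 < p < q)%N -> (q <= n)%N ->
       (if b == c then t a d p q else 0) = ut_mul (e a b) (t c d p q)
       /\ ut_mul (t a b c d) (e p q) = (if d == p then t a b c q else 0)) ->
  bimodule_product (ut_ext t).
Proof.
move=> H; have [s1 s2] := ut_ext_bilinear t.
apply: bimodule_product_on_basis => // a b c d p q ab bn cd dn pq qn.
have [H1 H2] := H a b c d p q ab bn cd dn pq qn.
rewrite !ut_e_mul // !ut_ext_e // -H1 H2.
split; case: eqP => [E|_].
- by rewrite ut_ext_e //; lia.
- exact: (linear_map0 (s1 (e p q))).
- by rewrite ut_ext_e //; lia.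
- exact: (esym (linear_map0 (s2 (e a b)))).
Qed.

(** * The four families *)

Ltac case_ifs :=
  repeat (case: ifPn => ?); rewrite ?ut_mul0r ?ut_mulr0 ?ut_e_mul //; try lia;
  repeat (case: ifPn => ?); try done; try lia.

Lemma M1_bimodule_product i j : (1 < i <= n)%N -> (1 <= j < n)%N ->
  bimodule_product (@M1 K n i j).
Proof.
move=> hi hj; apply: bimodule_product_ext => a b c d p q ab bn cd dn pq qn.
split; case_ifs.
Qed.

Lemma M2_bimodule_product i j : (1 < i <= n)%N -> (1 <= j < n)%N ->
  bimodule_product (@M2 K n i j).
Proof.
move=> hi hj; apply: bimodule_product_ext => a b c d p q ab bn cd dn pq qn.
split; case_ifs.
Qed.

(** Without [i <= j.+1], the pair [e_{i-1,i}], [e_{j,j+1}] would be sent to 0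
    by the table, although other pairs are not, and compatibility would fail. *)
Lemma M3_bimodule_product i j : (2 < i <= j.+1)%N -> (j.+1 < n)%N ->
  bimodule_product (@M3 K n i j).
Proof.
move=> hi hj; apply: bimodule_product_ext => a b c d p q ab bn cd dn pq qn.
split; case_ifs.
Qed.

Lemma M4_bimodule_product i j : (2 < i <= n)%N -> (1 <= j < n.-1)%N ->
  bimodule_product (@M4 K n i j).
Proof.
move=> hi hj; apply: bimodule_product_ext => a b c d p q ab bn cd dn pq qn.
split; case_ifs.
Qed.

Definition M_comb (c1 c2 c3 c4 : nat -> nat -> K) x y : utn :=
      \sum_(1 <= i < n.+1) \sum_(1 <= j < n.+1 | (1 < i <= n)%N && (1 <= j < n)%N)
        c1 i j *: M1 i j x y
    + \sum_(1 <= i < n.+1) \sum_(1 <= j < n.+1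
          | [&& (1 < i <= n)%N, (1 <= j < n)%N & (i, j) != (2, n.-1)%N])
        c2 i j *: M2 i j x y
    + \sum_(1 <= i < n.+1) \sum_(1 <= j < n.+1 | (2 < i <= j.+1)%N && (j.+1 < n)%N)
        c3 i j *: M3 i j x y
    + \sum_(1 <= i < n.+1) \sum_(1 <= j < n.+1 | (2 < i <= n)%N && (1 <= j < n.-1)%N)
        c4 i j *: M4 i j x y.

Lemma M_comb_bimodule_product c1 c2 c3 c4 : bimodule_product (M_comb c1 c2 c3 c4).
Proof.
do 3?[apply: bimodule_productD]; do 2!apply: bimodule_product_sum => ? ?;
  apply: bimodule_productZ.
- by apply: M1_bimodule_product; lia.
- by apply: M2_bimodule_product; lia.
- by apply: M3_bimodule_product; lia.
- by apply: M4_bimodule_product; lia.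
Qed.

(** * A bimodule product is determined on the simple matrix units *)

(** Since [e_{ab} = e_{a,b-1} e_{b-1,b}], the simple matrix units generate
    [ut K n] as a left ideal. *)
Lemma ut_left_gen_ind (P : utn -> Prop) :
    P 0 -> (forall c x y, P x -> P y -> P (c *: x + y)) ->
    (forall x y, P y -> P (ut_mul x y)) ->
    (forall i, (1 < i <= n)%N -> P (e i.-1 i)) ->
  forall x, P x.
Proof.
move=> P0 Plin PM Pe; apply: ut_basis_ind => // a b ab bn.
have [<-|ab1] := eqVneq b.-1 a; first by apply: Pe; lia.
have -> : e a b = ut_mul (e a b.-1) (e b.-1 b) by rewrite ut_e_mul ?eqxx //; lia.
by apply: PM; apply: Pe; lia.
Qed.

(** Since [e_{ab} = e_{a,a+1} e_{a+1,b}], they also generate it as a right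
    ideal. *)
Lemma ut_right_gen_ind (P : utn -> Prop) :
    P 0 -> (forall c x y, P x -> P y -> P (c *: x + y)) ->
    (forall x y, P x -> P (ut_mul x y)) ->
    (forall j, (1 <= j < n)%N -> P (e j j.+1)) ->
  forall x, P x.
Proof.
move=> P0 Plin PM Pe; apply: ut_basis_ind => // a b ab bn.
have [<-|ab1] := eqVneq a.+1 b; first by apply: Pe; lia.
have -> : e a b = ut_mul (e a a.+1) (e a.+1 b) by rewrite ut_e_mul ?eqxx //; lia.
by apply: PM; apply: Pe; lia.
Qed.

(** Left linearity reduces the first argument to a simple matrix unit, right
    linearity the second. *)
Lemma eq_bimodule_product_gen f g : bimodule_product f -> bimodule_product g ->
    (forall i j, (1 < i <= n)%N -> (1 <= j < n)%N ->
       f (e i.-1 i) (e j j.+1) = g (e i.-1 i) (e j j.+1)) ->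
  f =2 g.
Proof.
move=> [[f1 f2] fl fr] [[g1 g2] gl gr] fg x y.
elim/ut_left_gen_ind: x => [|c x z fgx fgz|x z fgz|i hi].
- by rewrite (linear_map0 (f1 y)) (linear_map0 (g1 y)).
- by rewrite f1 g1 fgx fgz.
- by rewrite fl gl fgz.
elim/ut_right_gen_ind: y => [|c y z fgy fgz|y z fgy|j hj].
- by rewrite !linear_map0.
- by rewrite f2 g2 fgy fgz.
- by rewrite -fr -gr fgy.
- exact: fg.
Qed.

(** * Values on simple matrix units *)

(** Row [p] of [star (e i.-1 i) y] is row 1 of its left multiple by [e 1 p],
    which is [star (e 1 p * e i.-1 i) y], a product with first factor 0. *)
Lemma bimodule_product_row0 star i p q y : bimodule_product star ->
    (1 < i <= n)%N -> (1 < p <= n)%N -> p != i.-1 ->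
  coord (star (e i.-1 i) y) p q = 0.
Proof.
move=> [[s1 s2] sl sr] hi hp pi; rewrite -(@coord_mul_e 1 p) //; try lia.
rewrite -sl ut_e_mul //; try lia.
by rewrite (negPf pi) (linear_map0 (s1 _)) coord0.
Qed.

(** The mirror image of [bimodule_product_row0], multiplying by [e q n] on the
    right. *)
Lemma bimodule_product_col0 star j p q x : bimodule_product star ->
    (1 <= j < n)%N -> (1 <= q < n)%N -> q != j.+1 ->
  coord (star x (e j j.+1)) p q = 0.
Proof.
move=> [[s1 s2] sl sr] hj hq qj; rewrite -(@coord_e_mul q n) //; try lia.
rewrite sr ut_e_mul //; try lia.
by rewrite eq_sym (negPf qj) (linear_map0 (s2 _)) coord0.
Qed.

Lemma sum_single (V : lmodType K) (Q : nat -> nat -> bool) (c : nat -> nat -> K)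
    (v : V) (F : nat -> nat -> V) i j :
    (1 <= i <= n)%N -> (1 <= j <= n)%N ->
    (forall i' j', F i' j' = if (i' == i) && (j' == j) then v else 0) ->
  \sum_(1 <= i' < n.+1) \sum_(1 <= j' < n.+1 | Q i' j') c i' j' *: F i' j'
    = if Q i j then c i j *: v else 0.
Proof.
move=> hi hj FE.
transitivity (\sum_(1 <= i' < n.+1 | i' == i) \sum_(1 <= j' < n.+1 | j' == j)
    if Q i' j' then c i' j' *: v else 0); last first.
  by rewrite !big_nat1_eq !ltnS hi hj.
rewrite [RHS]big_mkcond; apply: eq_bigr => i' _; rewrite big_mkcond.
case: eqP => [->|ne]; last first.
  rewrite big1 // => j' _; rewrite FE.
  by case: eqP ne => //= _ _; rewrite scaler0 if_same.
rewrite [RHS]big_mkcond; apply: eq_bigr => j' _; rewrite FE eqxx /=.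
by case: eqP; rewrite ?scaler0 ?if_same.
Qed.

(** At a given pair of simple matrix units, a member of a family
    vanishes unless its index is that pair. *)
Lemma M_comb_gen c1 c2 c3 c4 i j : (1 < i <= n)%N -> (1 <= j < n)%N ->
  M_comb c1 c2 c3 c4 (e i.-1 i) (e j j.+1) =
    c1 i j *: e 1 j.+1
  + (if (i, j) != (2, n.-1)%N then c2 i j *: e i.-1 n else 0)
  + (if (2 < i <= j.+1)%N && (j.+1 < n)%N then c3 i j *: e i.-1 j.+1 else 0)
  + (if (2 < i)%N && (j < n.-1)%N then c4 i j *: e 1 n else 0).
Proof.
move=> hi hj; rewrite /M_comb.
rewrite (@sum_single _ _ _ (e 1 j.+1) _ i j); try lia; last first.
  by move=> i' j'; rewrite /M1 ut_ext_e; try lia;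
    case: ifPn => ?; case: ifPn => ? //; lia.
rewrite (@sum_single _ _ _ (e i.-1 n) _ i j); try lia; last first.
  by move=> i' j'; rewrite /M2 ut_ext_e; try lia;
    case: ifPn => ?; case: ifPn => ? //; lia.
rewrite (@sum_single _ _ _ (e i.-1 j.+1) _ i j); try lia; last first.
  by move=> i' j'; rewrite /M3 ut_ext_e; try lia;
    case: ifPn => ?; case: ifPn => ? //; lia.
rewrite (@sum_single _ _ _ (e 1 n) _ i j); try lia; last first.
  by move=> i' j'; rewrite /M4 ut_ext_e; try lia;
    case: ifPn => ?; case: ifPn => ? //; lia.
have [hi1 hi2] := andP hi; have [hj1 hj2] := andP hj.
by rewrite hi1 hi2 hj1 hj2 !andbT.
Qed.

(** The coefficients are the four entries of [F i j] that may be nonzero. *)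
Lemma bimodule_product_span star : bimodule_product star -> in_M_span star.
Proof.
move=> sP; pose F i j := star (e i.-1 i) (e j j.+1).
pose c1 i j := coord (F i j) 1 j.+1; pose c2 i j := coord (F i j) i.-1 n.
pose c3 i j := coord (F i j) i.-1 j.+1; pose c4 i j := coord (F i j) 1 n.
exists c1, c2, c3, c4 => x y; rewrite -/(M_comb c1 c2 c3 c4 x y).
apply: (eq_bimodule_product_gen sP) => [|i j hi hj].
  exact: M_comb_bimodule_product.
rewrite M_comb_gen //; apply: eq_coord => p q pq qn; rewrite -/(F i j).
have coord_if (b : bool) c k l : (b -> (0 < k < l)%N && (l <= n)%N) ->
    coord (if b then c *: e k l else 0) p q = c *+ [&& b, p == k & q == l].
  case: b => [/(_ isT)/andP[kl ln]|_]; last exact: coord0.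
  by rewrite coordZ coord_e // mulr_natr.
rewrite !coordD (coord_if true) ?coord_if; try lia.
rewrite xpair_eqE.
(* The index restrictions make the four positions on the right pairwise
   distinct, so at most one summand contributes at (p, q); if none does, then
   (p, q) lies outside the rows 1, i-1 or outside the columns j+1, n. *)
case: (boolP [&& true, p == 1 & q == j.+1]) => B1;
  case: (boolP [&& _, p == i.-1 & q == n]) => B2;
  case: (boolP [&& _, p == i.-1 & q == j.+1]) => B3;
  case: (boolP [&& _, p == 1 & q == n]) => B4; try lia;
  rewrite ?mulr1n ?mulr0n ?addr0 ?add0r.
- by have [-> ->] : p = 1%N /\ q = j.+1 by lia.
- by have [-> ->] : p = i.-1 /\ q = n by lia.
- by have [-> ->] : p = i.-1 /\ q = j.+1 by lia.
- by have [-> ->] : p = 1%N /\ q = n by lia.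
have [p1|p1] := boolP ((p == 1) || (p == i.-1)).
  by apply: bimodule_product_col0 => //; lia.
by apply: bimodule_product_row0 => //; lia.
Qed.

End IdMatchingProducts.

Theorem theorem2p9 (K : fieldType) (n : nat) (hn : (2 < n)%N)
    (star : ut K n -> ut K n -> ut K n) :
  id_matching (@ut_mul K n) star <-> associative star /\ in_M_span star.
Proof.
split=> [[sb sA sl sr]|[sA [c1 [c2 [c3 [c4 sE]]]]]].
  by split=> //; apply: bimodule_product_span; split.
have [sb sl sr] : bimodule_product star.
  apply: (eq_bimodule_product _ (@M_comb_bimodule_product K n c1 c2 c3 c4)) => x y.
  by rewrite sE.
by split.
Qed.
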